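(* Let the edge passage times $X_e$ be i.i.d. positive random variables with tail probability function $H(x)=\mathbb{P}(X_e>x)$, $x\in\mathbb{R}$. (i) If $H(x)\sim e^{-\lambda x}$ as $x\to\infty$ for some $\lambda>0$, then for any $\epsilon>0$, $$\lim_{n\to\infty}\mathbb{P}\left((1-\epsilon)\frac{\ln n-\ln\ln n}{\lambda}\le\frac{W_n}{n}\le\frac{2\ln n+\ln\ln n}{\lambda}\right)=1 .$$ (ii) If $H(x)\sim x^{-\alpha}$ as $x\to\infty$ for some $\alpha>0$, then for any $\epsilon>0$, $$\lim_{n\to\infty}\mathbb{P}\left((1-\epsilon)\,n^{\frac1\alpha}(\ln n)^{-\frac1\alpha}\le\frac{W_n}{n}\le n^{\frac2\alpha}(\ln\ln n)^{\frac1\alpha}\right)=1 .$$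
   Context: Last passage percolation on the complete graph. $G_n=([n],E_n)$ is the complete graph on $[n]=\{1,\dots,n\}$, with $E_n=\{\langle i,j\rangle:1\le i<j\le n\}$. Each edge $e\in E_n$ carries a positive random passage time $X_e$, and $\{X_e:e\in E_n\}$ are independent and identically distributed, with a common law not depending on $n$. For $n\ge2$, $\Pi_{1,n}$ is the set of all self-avoiding paths in $G_n$ from vertex $1$ to vertex $n$ (no repeated vertices). The passage time of a path $\pi$ is $T(\pi)=\sum_{e\in\pi}X_e$, and $W_n=\sup_{\pi\in\Pi_{1,n}}T(\pi)$. The notation $a(x)\sim b(x)$ as $x\to\infty$ means $a(x)/b(x)\to1$. *)

(* Defs.v *)
From HB Require Import structures.
From mathcomp Require Import all_boot all_order all_algebra.
From mathcomp Require Import all_classical all_reals all_analysis.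

Set Implicit Arguments.
Unset Strict Implicit.
Unset Printing Implicit Defensive.
Import Order.TTheory GRing.Theory Num.Theory.
Import numFieldNormedType.Exports.
Local Open Scope classical_set_scope.
Local Open Scope ring_scope.

(* The vertex called k in {1, ..., n} is the element of 'I_n of value k - 1. *)
Definition edge (n : nat) : finType := {e : 'I_n * 'I_n | (e.1 < e.2)%N}.

(* A path is the sequence of its vertices, both endpoints included.  The graph
   is complete, so consecutive vertices only have to be distinct. *)
Definition self_avoiding_path (n : nat) (p : seq 'I_n) : Prop :=
  exists (x : 'I_n) (q : seq 'I_n),
    [/\ p = x :: q, val x = 0%N, val (last x q) = n.-1 & uniq p].

Definition edge_on_path (n : nat) (p : seq 'I_n) (e : edge n) : bool :=
  let: (i, j) := val e in
  ((i, j) \in zip p (behead p)) || ((j, i) \in zip p (behead p)).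

Definition passage_time (R : realType) (n : nat) (x : edge n -> R)
    (p : seq 'I_n) : R :=
  \sum_(e : edge n | edge_on_path p e) x e.

(* For 2 <= n this is the supremum of a nonempty finite set; for n = 0 there is
   no path and the value is sup set0 = 0. *)
Definition last_passage_time (R : realType) (n : nat) (x : edge n -> R) : R :=
  sup [set passage_time x p | p in @self_avoiding_path n].

Definition independent_RVs (R : realType) (d : measure_display)
    (T : measurableType d) (P : probability T R) (I : finType)
    (X : I -> {RV P >-> R}) : Prop :=
  forall (J : {set I}) (B : I -> set R), (forall i, measurable (B i)) ->
    P (\bigcap_(i in [set` J]) X i @^-1` B i) =
    (\prod_(i in J) P (X i @^-1` B i))%E.

Definition asymptotically_equivalent (R : realType) (a b : R -> R) : Prop :=
  a x / b x @[x --> +oo] --> (1 : R).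

(* Main.v *)
(** If no edge is heavier than b, then W_n <= n b, and the upper bounds follow
    from a union bound over the n(n-1)/2 edges.

    For the lower bounds, call an edge heavy when it exceeds a level c_n with
    n H(c_n) -> oo, and build a Hamiltonian path greedily, moving along a heavy
    edge to an unvisited vertex whenever there is one.  A vertex at which this
    fails has no heavy edge to any later vertex of the path.  So k failures
    occurring before the last k vertices would give two disjoint sets of k
    vertices without a heavy edge between them; otherwise the path has at least
    n - 2 - 2k heavy edges.  Such a pair of sets exists with probability at most
    4^n (1 - H(c_n))^(k^2), which tends to 0 for k proportional to n. *)

Require Import Defs.
From HB Require Import structures.
From mathcomp Require Import all_boot all_order all_algebra.
From mathcomp Require Import all_classical all_reals all_analysis.
From mathcomp Require Import lra.
Import Order.TTheory GRing.Theory Num.Theory.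
Import numFieldNormedType.Exports.
Local Open Scope classical_set_scope.
Local Open Scope ring_scope.

Set Implicit Arguments.
Unset Strict Implicit.

(** * Greedy arrangements of a finite vertex set *)

(* Along u :: q, every vertex either is related to its successor or is related
   to no later vertex. *)
Fixpoint greedy (V : eqType) (r : rel V) (u : V) (q : seq V) : bool :=
  if q is v :: q' then
    (r u v || all (fun w => ~~ r u w) q) && greedy r v q'
  else true.

(** Move to a related vertex of [s] if there is one, otherwise to any vertex, and recurse on what
    remains. The failure clause speaks of the set of remaining vertices only, so it survives their
    later rearrangement. *)
Lemma greedy_arrangement (V : eqType) (r : rel V) (u : V) (s : seq V) :
  exists2 q, perm_eq q s & greedy r u q.
Proof.
have [m] := ubnP (size s); elim: m u s => [//|m IH] u s sm.
case: s sm => [|y s] sm; first by exists [::].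
suff [v vs hv] : exists2 v, v \in y :: s &
    r u v || all (fun w => ~~ r u w) (y :: s).
  have pv := perm_to_rem vs.
  have sr : (size (rem v (y :: s)) < m)%N.
    by rewrite size_rem.
  have [q qs gq] := IH v _ sr.
  have pq : perm_eq (v :: q) (y :: s).
    by rewrite perm_sym (perm_trans pv)// perm_cons perm_sym.
  by exists (v :: q) => //=; rewrite gq andbT -(perm_all _ pq) in hv *.
have [/hasP[v vs rv]|nh] := boolP (has (r u) (y :: s)).
  by exists v => //; rewrite rv.
by exists y; [rewrite mem_head | rewrite all_predC nh orbT].
Qed.

(** The list [f] collects the vertices of [u :: q], the last one excluded, at which the move fails.
    Each step along [q] is either a failure or a success counted by [pairmap], and a failed vertex
    is unrelated to everything later, hence to all of [s]. *)
Lemma greedy_failures (V : eqType) (r : rel V) (u : V) (q s : seq V) :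
  greedy r u (q ++ s) ->
  exists f, [/\ subseq f (belast u q),
    (size f + count id (pairmap r u q))%N = size q &
    forall v w, v \in f -> w \in s -> ~~ r v w].
Proof.
elim: q u => [|y q IH] u /=; first by exists [::].
move=> /andP[ruy /IH[f [sf cf hf]]].
have [ry|nry] := boolP (r u y).
  exists f; split => //; last by rewrite add1n addnS cf.
  exact: (subseq_trans sf (subseq_cons _ _)).
exists (u :: f); split => /=; first by rewrite eqxx.
  by rewrite add0n addSn cf.
move: ruy; rewrite (negbTE nry) /= => /allP hu v w.
rewrite inE => /predU1P[->|vf] ws; last exact: hf.
by apply: hu; rewrite mem_cat ws orbT.
Qed.

Lemma greedy_count (V : finType) (r : rel V) (k : nat) (u : V) (q : seq V) :
  (forall A B : {set V}, #|A| = k -> #|B| = k -> {in A, forall v, v \notin B} ->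
     exists2 v, v \in A & exists2 w, w \in B & r v w) ->
  uniq (u :: q) -> greedy r u q ->
  (size q <= count id (pairmap r u q) + k.*2)%N.
Proof.
move=> hr uq gq.
have [qk|kq] := leqP (size q) k.
  by rewrite (leq_trans qk)// -addnn addnA leq_addl.
set q1 := take (size q - k) q; set s := drop (size q - k) q.
have qE : q = q1 ++ s by rewrite cat_take_drop.
have ss : size s = k by rewrite size_drop subKn// ltnW.
have s1 : size q1 = (size q - k)%N by rewrite size_take_min (minn_idPl _)// leq_subr.
move: gq; rewrite {1}qE => /greedy_failures[f [sf cf hf]].
have uq1 : uniq ((u :: q1) ++ s) by rewrite cat_cons -qE.
have ub : uniq (belast u q1).
  by move: uq1; rewrite cat_uniq => /andP[]; rewrite lastI rcons_uniq => /andP[].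
have uf : uniq f by exact: subseq_uniq sf ub.
have us : uniq s by move: uq1; rewrite cat_uniq => /and3P[].
(* With more than [k] failures, the first [k] of them and the last [k] vertices would be two
   disjoint sets contradicting [hr]. *)
have fk : (size f <= k)%N.
  rewrite leqNgt; apply/negP => kf.
  have st : size (take k f) = k by rewrite size_take kf.
  have [||| v] := hr [set v in take k f] [set w in s].
  - by rewrite cardsE (card_uniqP _) ?take_uniq.
  - by rewrite cardsE (card_uniqP _).
  - move=> v; rewrite !inE => /mem_take/(mem_subseq sf)/mem_belast vq.
    apply/negP => vs.
    by move: uq1; rewrite cat_uniq => /and3P[_ /hasP[]]; exists v.
  rewrite inE => /mem_take vf [w]; rewrite inE => ws rvw.
  by move: (hf v w vf ws); rewrite rvw.
(* Of the [2k] steps given away, [k] account for failures along [q1] and [k] for the steps into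
   [s]. *)
have -> : (size q = size q1 + k)%N by rewrite s1 subnK// ltnW.
rewrite -addnn addnA leq_add2r -cf addnC leq_add//.
by rewrite qE pairmap_cat count_cat leq_addr.
Qed.

(** * Passage times as sums along the vertex sequence *)

(* The weight of the edge joining u and v, whatever their order; 0 if u = v. *)
Definition pair_weight (R : realType) (n : nat) (x : edge n -> R)
    (u v : 'I_n) : R :=
  \sum_(e : edge n | (val e == (u, v)) || (val e == (v, u))) x e.

(** Edges are stored with increasing endpoints, so exactly one of the two orientations occurs and
    the sum has a single term. *)
Lemma pair_weight_edge (R : realType) (n : nat) (x : edge n -> R) (u v : 'I_n) :
  u != v -> exists2 e : edge n, (val e == (u, v)) || (val e == (v, u)) &
     pair_weight x u v = x e.
Proof.
move=> uv.
have [uv'|uv'] : (u < v)%N \/ (v < u)%N.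
  by apply/orP; rewrite -neq_ltn; exact: uv.
  exists (exist (fun e : 'I_n * 'I_n => (e.1 < e.2)%N) (u, v) uv').
    by rewrite /= eqxx.
  rewrite /pair_weight (big_pred1 (exist _ (u, v) uv'))// => e /=.
  rewrite -val_eqE /=.
  case: eqP => //= _; apply/eqP => ee.
  by have /= := valP e; rewrite ee /= ltnNge ltnW.
exists (exist (fun e : 'I_n * 'I_n => (e.1 < e.2)%N) (v, u) uv').
  by rewrite /= eqxx orbT.
rewrite /pair_weight (big_pred1 (exist _ (v, u) uv'))// => e /=.
rewrite -val_eqE /= orbC.
case: eqP => //= _; apply/eqP => ee.
by have /= := valP e; rewrite ee /= ltnNge ltnW.
Qed.

(** Induction on the path: the edges are split according to whether they join [u] to [v]. Since [u]
    does not recur, that edge is not met again later and is counted once. *)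
Lemma passage_time_pairmap (R : realType) (n : nat) (x : edge n -> R) u q :
  uniq (u :: q) ->
  passage_time x (u :: q) = \sum_(z <- pairmap (pair_weight x) u q) z.
Proof.
elim: q u => [|v q IH] u.
  move=> _; rewrite /passage_time big_nil big1// => e.
  by rewrite /edge_on_path /=; case: (val e).
move=> /andP[uvq uq]; rewrite [pairmap _ _ _]/= big_cons -IH//.
rewrite /passage_time (bigID (fun e : edge n => (val e == (u, v)) || (val e == (v, u)))) /=.
have zmem (a b : 'I_n) : ((a, b) \in zip (v :: q) q) ->
    a \in v :: q /\ b \in v :: q.
  move=> /nthP => /(_ (u, u)) [i]; rewrite size_zip => ilt.
  rewrite nth_zip_cond size_zip ilt => -[<- <-].
  move: ilt; rewrite ltn_min => /andP[i1 i2].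
  by rewrite mem_nth// inE mem_nth// orbT.
congr (_ + _); apply: eq_bigl => e; rewrite /edge_on_path /=;
  case: (val e) => a b; rewrite !inE !xpair_eqE.
  by case: (a == u); case: (b == v); case: (a == v); case: (b == u);
    rewrite /= ?orbT ?andbT ?andbF.
(* An edge used by the rest of the path has both endpoints in [v :: q], so it avoids [u]. *)
case uab : (((a, b) \in zip (v :: q) q) || ((b, a) \in zip (v :: q) q)).
  have [au bu] : a != u /\ b != u.
    by move: uab => /orP[] /zmem[az bz]; split;
      apply: contraNneq uvq => <-.
  rewrite (negbTE au) (negbTE bu) !andbF/= andbT.
  by case/orP: uab => ->; rewrite ?orbT.
by move/negbT: uab; rewrite negb_or => /andP[/negbTE-> /negbTE->];
  case: (a == u); case: (b == v); case: (a == v); case: (b == u).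
Qed.

(** * The last passage time as a finite maximum, and its measurability *)

Lemma self_avoiding_path_rcons (n : nat) (s : seq 'I_n) (u v : 'I_n) :
  val u = 0%N -> val v = n.-1 -> uniq (u :: rcons s v) ->
  self_avoiding_path (u :: rcons s v).
Proof.
by move=> u0 vn us; exists u, (rcons s v); split; rewrite ?last_rcons.
Qed.

(** A passage time depends only on the set of edges used. Vertex sequences form an infinite type,
    whereas sets of edges form a finite one, over which maxima and unions can be taken. *)
Definition is_path_edge_set (n : nat) (A : {set edge n}) : bool :=
  `[< exists2 p, self_avoiding_path p & A = [set e | edge_on_path p e]%SET >].

Lemma passage_time_edges (R : realType) (n : nat) (x : edge n -> R) p :
  passage_time x p = \sum_(e in [set e | edge_on_path p e]%SET) x e.
Proof. by apply: eq_bigl => e; rewrite inE. Qed.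

Lemma is_path_edge_set_exists (n : nat) : (1 < n)%N -> exists A, @is_path_edge_set n A.
Proof.
case: n => [|[|n]]// _.
exists [set e | edge_on_path (ord0 :: rcons [::] ord_max) e]%SET.
apply/asboolP; exists (ord0 :: rcons [::] ord_max) => //.
exact: self_avoiding_path_rcons.
Qed.

(** A maximiser over the finite family of edge sets gives a passage time that bounds all the others,
    so the supremum is attained there. *)
Lemma last_passage_time_max (R : realType) (n : nat) (x : edge n -> R) :
  (1 < n)%N ->
  (exists2 A, @is_path_edge_set n A & last_passage_time x = \sum_(e in A) x e) /\
  (forall A, @is_path_edge_set n A -> \sum_(e in A) x e <= last_passage_time x).
Proof.
move=> /is_path_edge_set_exists[A0 pA0].
have [A pA Amax] := @arg_maxP _ R _ A0 (@is_path_edge_set n) (fun A => \sum_(e in A) x e) pA0.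
have -> : last_passage_time x = \sum_(e in A) x e.
  rewrite /last_passage_time; apply/eqP; rewrite eq_le; apply/andP; split.
    apply: ge_sup.
      move/asboolP: pA0 => [p sp _]; exists (passage_time x p).
      by exists p.
    move=> _ [p sp <-]; rewrite passage_time_edges; apply: Amax.
    by apply/asboolP; exists p.
  apply: sup_ubound.
    exists (\sum_(e in A) x e) => _ [p sp <-].
    by rewrite passage_time_edges; apply: Amax; apply/asboolP; exists p.
  by move/asboolP: pA => [p sp ->]; exists p => //; rewrite passage_time_edges.
split; first by exists A.
by move=> B /Amax.
Qed.

Lemma last_passage_time_ge (R : realType) (n : nat) (x : edge n -> R) p :
  (1 < n)%N -> self_avoiding_path p -> passage_time x p <= last_passage_time x.
Proof.
move=> /(last_passage_time_max x)[_ h] sp; rewrite passage_time_edges.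
by apply: h; apply/asboolP; exists p.
Qed.

Lemma last_passage_time_le (R : realType) (n : nat) (x : edge n -> R) (c : R) :
  (1 < n)%N -> (forall p, self_avoiding_path p -> passage_time x p <= c) ->
  last_passage_time x <= c.
Proof.
move=> /(last_passage_time_max x)[[A /asboolP[p sp ->] ->] _] /(_ p sp).
by rewrite passage_time_edges.
Qed.

(** Closed right rays generate the Borel sets. As the supremum is attained, it reaches [a] exactly
    when some path does, and this is a finite union of measurable events. *)
Lemma measurable_last_passage_time (R : realType) (d : measure_display)
    (T : measurableType d) (n : nat) (X : edge n -> T -> R) :
  (1 < n)%N -> (forall e, measurable_fun setT (X e)) ->
  measurable_fun setT (fun w => last_passage_time (fun e => X e w)).
Proof.
move=> n1 mX.
apply: (measurability (@measurable_realfun.RGenCInfty.G R)) => [|/= _ [_] [a] -> <-].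
  exact: measurable_realfun.RGenCInfty.measurableE.
rewrite setTI.
suff -> : (fun w => last_passage_time (fun e => X e w)) @^-1` `[a, +oo[%classic =
    \bigcup_(A in [set` @is_path_edge_set n]) [set w | a <= \sum_(e in A) X e w].
  apply: fin_bigcup_measurable => [|A _]; first exact: finite_finset.
  rewrite -[X in measurable X]setTI; apply: measurable_fun_le => //.
  under eq_fun do rewrite big_mkcond/=.
  by apply: measurable_sum => e; case: (e \in A).
apply/seteqP; split => w /=; rewrite in_itv/= andbT;
  have [[A pA WA] hA] := last_passage_time_max (X^~ w) n1.
  by rewrite WA => aA; exists A.
by move=> [B pB] /le_trans; apply; exact: hA.
Qed.

(** * Deterministic bounds on the last passage time *)

Lemma last_passage_time_upper (R : realType) (n : nat) (x : edge n -> R) (b : R) :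
  (1 < n)%N -> 0 <= b -> (forall e, x e <= b) -> last_passage_time x <= n%:R * b.
Proof.
move=> n1 b0 xb; apply: last_passage_time_le => // _ [u [q [-> _ _ uq]]].
rewrite passage_time_pairmap//.
have qn : (size q <= n)%N.
  by have := max_card (mem (u :: q)); rewrite (card_uniqP uq) card_ord => /ltnW.
apply: (@le_trans _ _ ((size q)%:R * b)); last by rewrite ler_wpM2r// ler_nat.
elim: q u uq {qn} => [|v q IH] u; first by rewrite big_nil mul0r.
move=> /andP[uvq uq]; rewrite /= big_cons -natr1 mulrDl mul1r addrC lerD ?IH//.
have uv : u != v by apply: contraNneq uvq => ->; rewrite mem_head.
by have [e _ ->] := pair_weight_edge x uv.
Qed.

Definition heavy (R : realType) (n : nat) (x : edge n -> R) (c : R) : rel 'I_n :=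
  fun u v => (u != v) && (c < pair_weight x u v).

Lemma last_passage_time_lower (R : realType) (n k : nat) (x : edge n -> R) (c : R) :
  (1 < n)%N -> 0 <= c -> (forall e, 0 <= x e) ->
  (forall A B : {set 'I_n}, #|A| = k -> #|B| = k -> {in A, forall v, v \notin B} ->
     exists2 v, v \in A & exists2 w, w \in B & heavy x c v w) ->
  (n%:R - 2 - (2 * k)%:R) * c <= last_passage_time x.
Proof.
move=> n1 c0 x0 hx; case: n n1 x x0 hx => [|[|n]]// _ x x0 hx.
set u : 'I_n.+2 := ord0; set v : 'I_n.+2 := ord_max.
(* The two endpoints are set aside: the path starts at [u], runs greedily through all other vertices
   and only then steps to [v]. Two fewer greedy steps than vertices are made, whence the [- 2] in
   the bound. *)
have [q pq gq] := @greedy_arrangement _ (heavy x c) u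
  (enum [pred w : 'I_n.+2 | (w != u) && (w != v)]).
have qE w : (w \in q) = (w != u) && (w != v) by rewrite (perm_mem pq) mem_enum inE.
have uq : uniq q by rewrite (perm_uniq pq) enum_uniq.
have usv : uniq (u :: rcons q v).
  by rewrite /= mem_rcons inE rcons_uniq !qE !eqxx andbF uq.
have sq : size q = n.
  have : #|mem (u :: rcons q v)| = n.+2.
    rewrite -[RHS]card_ord; apply: eq_card => w.
    rewrite !inE mem_rcons inE qE.
    by case: (w == u); case: (w == v).
  by rewrite (card_uniqP usv) /= size_rcons => -[].
have uq' : uniq (u :: q) by rewrite /= qE eqxx.
have hc := greedy_count hx uq' gq.
have sap : self_avoiding_path (u :: rcons q v) by exact: self_avoiding_path_rcons.
apply: (le_trans _ (last_passage_time_ge x isT sap)).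
rewrite passage_time_pairmap//.
have Y0 (a b : 'I_n.+2) : 0 <= pair_weight x a b by exact: sumr_ge0.
apply: (@le_trans _ _ ((count id (pairmap (heavy x c) u q))%:R * c)).
  apply: ler_wpM2r => //; have -> : n.+2%:R - 2 = n%:R :> R by rewrite -addn2 natrD addrK.
  by rewrite lerBlDr -natrD ler_nat mul2n -{1}sq.
(* Each heavy step contributes at least [c]; every other step, including the final one into [v],
   contributes at least 0. *)
elim: q u {pq gq qE uq usv sq uq' hc sap} => [|y q IH] a /=.
  by rewrite mul0r big_cons big_nil addr0.
rewrite big_cons natrD mulrDl lerD ?IH//.
rewrite /heavy; case: (_ && _) / andP => [[_ /ltW]|_]; first by rewrite mul1r.
by rewrite mul0r.
Qed.

(** * Probability estimates for a fixed number of vertices *)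

Lemma probability_bigcup_le (R : realType) (d : measure_display)
    (T : measurableType d) (P : probability T R) (I : finType) (D : pred I)
    (A : I -> set T) (c : R) :
  0 <= c -> (forall i, D i -> measurable (A i)) ->
  (forall i, D i -> (P (A i) <= c%:E)%E) ->
  (P (\bigcup_(i in [set` D]) A i) <= (#|I|%:R * c)%:E)%E.
Proof.
move=> c0 mA hA.
have finD : finite_set [set` D] by exact: finite_finset.
have mU : measurable (\bigcup_(i in [set` D]) A i) by exact: fin_bigcup_measurable.
apply: (le_trans (content_sub_fsum P finD mA mU (@subset_refl _ _))).
rewrite -(@bigfs _ _ _ _ (index_enum I) D) ?index_enum_uniq//; last first.
  by move=> i _; rewrite mem_index_enum.
apply: (@le_trans _ _ (\sum_(i | D i) c%:E)%E); first exact: lee_sum.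
rewrite sumEFin lee_fin sumr_const -[c *+ _]mulr_natl ler_wpM2r// ler_nat.
exact: max_card.
Qed.

(** Two cases are needed because the endpoint in [A] may be the smaller or the larger one of the
    stored pair. *)
Definition between (n : nat) (A B : {set 'I_n}) : {set edge n} :=
  [set e : edge n | ((val e).1 \in A) && ((val e).2 \in B)
                 || ((val e).2 \in A) && ((val e).1 \in B)]%SET.

(** The map [g] puts the endpoint in [A] first. By disjointness, each pair of [A] times [B] is
    joined by an edge, so the product lies in the image of [between A B] under [g]. *)
Lemma card_between (n : nat) (A B : {set 'I_n}) :
  {in A, forall v, v \notin B} -> (#|A| * #|B| <= #|between A B|)%N.
Proof.
move=> AB; rewrite -cardsX.
pose g (e : edge n) := if (val e).1 \in A then val e else ((val e).2, (val e).1).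
apply: leq_trans (leq_imset_card g _).
apply/subset_leq_card/fintype.subsetP => -[u v]; rewrite inE /= => /andP[uA vB].
have uv : u != v by apply: contraNneq (AB u uA) => ->.
have vA : v \notin A by apply: contraL vB => /AB.
have /orP[uv'|uv'] : (u < v)%N || (v < u)%N by rewrite -neq_ltn; exact: uv.
  apply/imsetP; exists (exist (fun e : 'I_n * 'I_n => (e.1 < e.2)%N) (u, v) uv').
    by rewrite inE /= uA vB.
  by rewrite /g /= uA.
apply/imsetP; exists (exist (fun e : 'I_n * 'I_n => (e.1 < e.2)%N) (v, u) uv').
  by rewrite inE /= uA vB orbT.
by rewrite /g /= (negbTE vA).
Qed.

Lemma heavy_between (R : realType) (n : nat) (x : edge n -> R) (c : R)
    (A B : {set 'I_n}) (e : edge n) :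
  {in A, forall v, v \notin B} -> e \in between A B -> c < x e ->
  exists2 v, v \in A & exists2 w, w \in B & heavy x c v w.
Proof.
move=> AB eJ ce.
have Ye u v : (val e == (u, v)) || (val e == (v, u)) -> u != v ->
    pair_weight x u v = x e.
  move=> euv uv; have [e' e'uv ->] := pair_weight_edge x uv.
  (* Two edges with the same endpoints coincide, since opposite orientations cannot both be
     increasing. *)
  congr x; apply/val_inj; have := valP e; have := valP e'.
  by case/orP: e'uv => /eqP->; case/orP: euv => /eqP-> //=;
    move=> /ltnW; rewrite leqNgt => /negP.
move: eJ; rewrite inE; case eE: (val e) => [a b] /=.
have main u v : (val e == (u, v)) || (val e == (v, u)) -> u \in A -> v \in B ->
    exists2 v, v \in A & exists2 w, w \in B & heavy x c v w.
  move=> euv uA vB; exists u => //; exists v => //.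
  have uv : u != v by apply: contraNneq (AB u uA) => ->.
  by rewrite /heavy uv Ye.
by case/orP => /andP[]; apply: main; rewrite eE eqxx ?orbT.
Qed.

(** By independence the probability is the power of [1 - h] with exponent the size of [J], and
    powers of a number in [0, 1] decrease. *)
Lemma probability_light (R : realType) (d : measure_display)
    (T : measurableType d) (P : probability T R) (n : nat)
    (X : edge n -> {RV P >-> R}) (c h : R) (J : {set edge n}) (m : nat) :
  independent_RVs X -> (forall e, P [set w | X e w > c] = h%:E) ->
  0 <= h <= 1 -> (m <= #|J|)%N ->
  (P (\bigcap_(e in [set` J]) X e @^-1` [set` `]-oo, c]]) <= ((1 - h) ^+ m)%:E)%E.
Proof.
move=> Xi Xh h01 mJ; rewrite Xi//.
have Pe e : P (X e @^-1` [set` `]-oo, c]]) = (1 - h)%:E.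
  have -> : X e @^-1` [set` `]-oo, c]] = ~` (X e @^-1` [set` `]c, +oo[]).
    by rewrite preimage_setC setCitvr.
  rewrite probability_setC; last exact: measurable_funPTI.
  by rewrite preimage_itvoy Xh.
under eq_bigr do rewrite Pe.
rewrite prodEFin prodr_const lee_fin.
by apply: ler_wiXn2l => //; lra.
Qed.

Lemma measurable_last_passage_event (R : realType) (d : measure_display)
    (T : measurableType d) (n : nat) (X : edge n -> T -> R) (a b : R) :
  (1 < n)%N -> (forall e, measurable_fun setT (X e)) ->
  measurable [set w | a <= last_passage_time (fun e => X e w) / n%:R <= b].
Proof.
move=> n1 mX; have n0 : 0 < n%:R :> R by rewrite ltr0n ltnW.
have mW := measurable_last_passage_time n1 mX.
pose W w := last_passage_time (fun e => X e w).
have -> : [set w | a <= W w / n%:R <= b] = W @^-1` [set` `[a * n%:R, b * n%:R]].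
  by apply/seteqP; split => w /=; rewrite in_itv/= ler_pdivlMr// ler_pdivrMr.
by rewrite -[X in measurable X]setTI; apply: mW.
Qed.

(** Three bad events are excluded: [B1], a nonpositive weight, which is null; [B2], a weight above
    [b]; and [B3], two disjoint [k]-sets with no weight above [c] between them. Off their union the
    deterministic bounds apply. *)
Lemma last_passage_time_probability (R : realType) (d : measure_display)
    (T : measurableType d) (P : probability T R) (n k : nat)
    (X : edge n -> {RV P >-> R}) (H : R -> R) (a b c : R) :
  (1 < n)%N -> 0 <= b -> 0 <= c -> a * n%:R <= (n%:R - 2 - (2 * k)%:R) * c ->
  (forall e, {ae P, forall w, 0 < X e w}) ->
  independent_RVs X ->
  (forall e x, P [set w | X e w > x] = (H x)%:E) ->
  ((1 - (4 ^+ n * (1 - H c) ^+ (k * k) + n%:R ^+ 2 * H b))%:E <=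
   P [set w | (a <= last_passage_time (fun e => X e w) / n%:R <= b)%R])%E.
Proof.
move=> n1 b0 c0 ac X0 Xi Xh.
have mgt (e : edge n) (x : R) : measurable [set w | X e w > x].
  by rewrite -preimage_itvoy; exact: measurable_funPTI.
have mle (e : edge n) (x : R) : measurable (X e @^-1` [set` `]-oo, x]]).
  exact: measurable_funPTI.
have H01 x : 0 <= H x <= 1.
  have e : edge n.
    case: n n1 {X X0 Xi Xh mgt mle ac} => [|[|n]] //= _.
    by exists (ord0, ord_max).
  by rewrite -!lee_fin -(Xh e) measure_ge0 probability_le1.
pose W w := last_passage_time (fun e => X e w).
have n0 : 0 < n%:R :> R by rewrite ltr0n ltnW.
have mE : measurable [set w | a <= W w / n%:R <= b].
  by apply: measurable_last_passage_event => // e.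
pose D (AB : {set 'I_n} * {set 'I_n}) : bool :=
  [&& #|AB.1| == k, #|AB.2| == k & [forall v in AB.1, v \notin AB.2]].
pose B1 := \bigcup_(e in [set` (predT : pred (edge n))]) X e @^-1` [set` `]-oo, 0]].
pose B2 := \bigcup_(e in [set` (predT : pred (edge n))]) [set w | X e w > b].
pose B3 := \bigcup_(AB in [set` D]) \bigcap_(e in [set` between AB.1 AB.2])
  X e @^-1` [set` `]-oo, c]].
have mB1 : measurable B1.
  by apply: fin_bigcup_measurable => //; exact: finite_finset.
have mB2 : measurable B2.
  by apply: fin_bigcup_measurable => //; exact: finite_finset.
have mB3e AB : measurable (\bigcap_(e in [set` between AB.1 AB.2])
  X e @^-1` [set` `]-oo, c]]).
  by apply: fin_bigcap_measurable => //; exact: finite_finset.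
have mB3 : measurable B3.
  by apply: fin_bigcup_measurable => //; exact: finite_finset.
have PB1 : (P B1 <= 0)%E.
  rewrite -[leRHS]/(0%:E) -(mulr0 (#|edge n|%:R)).
  apply: probability_bigcup_le => // e _.
  have [N [mN PN subN]] := X0 e.
  apply: (@le_trans _ _ (P N)); last by rewrite PN.
  apply: le_measure; rewrite ?inE// => w /=; rewrite in_itv/= => Xw.
  by apply: subN => /=; apply/negP; rewrite -leNgt.
have PB2 : (P B2 <= (n%:R ^+ 2 * H b)%:E)%E.
  have Hb := H01 b.
  apply: (@le_trans _ _ (#|edge n|%:R * H b)%:E).
    apply: probability_bigcup_le => // [|e _]; first by case/andP: Hb.
    by rewrite Xh.
  rewrite lee_fin ler_wpM2r//; first by case/andP: Hb.
  rewrite -natrX ler_nat card_sig.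
  by apply: leq_trans (max_card _) _; rewrite card_prod !card_ord mulnn.
have PB3 : (P B3 <= (4 ^+ n * (1 - H c) ^+ (k * k))%:E)%E.
  (* The union bound runs over all pairs of vertex sets, [2 ^ n] choices for each. *)
  have -> : 4 ^+ n = #|{: {set 'I_n} * {set 'I_n}}|%:R :> R.
    by rewrite card_prod -cardsT -powersetT card_powerset cardsT card_ord -expnMn natrX.
  have Hc := H01 c.
  apply: probability_bigcup_le => //; first by apply: exprn_ge0; lra.
  move=> [A B] /and3P[/eqP/= Ak /eqP Bk /forall_inP AB].
  apply: probability_light => //; rewrite -{1}Ak -Bk.
  exact: card_between.
have sub : ~` [set w | a <= W w / n%:R <= b] `<=` B1 `|` B2 `|` B3.
  move=> w /= nE; apply: contrapT => /not_orP[/not_orP[nB1 nB2] nB3]; apply: nE.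
  have x0 e : 0 < X e w.
    by rewrite ltNge; apply/negP => Xw; apply: nB1; exists e => //=; rewrite in_itv.
  have xb e : X e w <= b.
    by rewrite leNgt; apply/negP => Xw; apply: nB2; exists e.
  rewrite ler_pdivlMr// ler_pdivrMr// [b * _]mulrC.
  rewrite last_passage_time_upper ?andbT//.
  apply: (le_trans ac); apply: last_passage_time_lower => // [e|A B Ak Bk AB].
    exact/ltW.
  apply: contrapT => nh; apply: nB3; exists (A, B).
    by apply/and3P; split; [apply/eqP|apply/eqP|apply/forall_inP].
  move=> e /= eAB; rewrite in_itv/= leNgt; apply/negP => ce; apply: nh.
  exact: (@heavy_between _ _ (X^~ w) c A B e).
have : (P (~` [set w | (a <= W w / n%:R <= b)%R]) <=
    (4 ^+ n * (1 - H c) ^+ (k * k) + n%:R ^+ 2 * H b)%:E)%E.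
  apply: (@le_trans _ _ (P (B1 `|` B2 `|` B3))).
    apply: le_measure => //; rewrite inE; first exact: measurableC.
    by do 2 ?apply: measurableU.
  have U12 : (P (B1 `|` B2) <= P B1 + P B2)%E by exact: measureU2.
  have U123 : (P (B1 `|` B2 `|` B3) <= P (B1 `|` B2) + P B3)%E.
    by apply: measureU2 => //; exact: measurableU.
  apply: (le_trans U123); rewrite addrC EFinD leeD//.
  by apply: (le_trans U12); rewrite -[leRHS]add0e leeD.
rewrite probability_setC//.
have /fineK <- : P [set w | a <= W w / n%:R <= b] \is a fin_num.
  exact: fin_num_measure.
by rewrite -EFinB !lee_fin; lra.
Qed.

(** * Passage to the limit for a general tail *)

Lemma asymptotically_equivalent_bounds (R : realType) (H g : R -> R) :
  (forall x, 0 < x -> 0 < g x) -> asymptotically_equivalent H g ->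
  \forall x \near +oo, g x / 2 <= H x <= 2 * g x.
Proof.
move=> g0 /cvgrPdist_le/(_ 2^-1); rewrite invr_gt0 ltr0n => /(_ isT) Hg.
near=> x.
have gx : 0 < g x by apply: g0; near: x; exact: nbhs_pinfty_gt.
have : `|1 - H x / g x| <= 2^-1 by near: x.
have := divfK (lt0r_neq0 gx) (H x).
rewrite ler_norml; move: (H x / g x) => q <- /andP[h1 h2].
by rewrite [g x / 2]mulrC !ler_pM2r//; apply/andP; split; lra.
Unshelve. all: by end_near. Qed.

(** With [4 <= e^2] and [1 - h <= e^(-h)] the exponent is at most [2n - h k^2]. Since
    [k >= delta n / 2], the hypothesis on [n h] gives [h k^2 >= 12 n / 4 = 3n]. *)
Lemma power_decay (R : realType) (n k : nat) (delta h : R) :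
  0 <= h <= 1 -> delta * n%:R <= 2 * k%:R -> 0 < delta ->
  12 / delta ^+ 2 <= n%:R * h ->
  4 ^+ n * (1 - h) ^+ (k * k) <= expR (- n%:R).
Proof.
move=> h01 kn d0 nh.
have e4 : 4 <= expR 2 :> R.
  have -> : expR 2 = expR 1 * expR 1 :> R by rewrite -expRD; congr expR; lra.
  have := expR_ge1Dx (1 : R); nra.
have eh : 1 - h <= expR (- h) by have := expR_ge1Dx (- h).
apply: (@le_trans _ _ (expR 2 ^+ n * expR (- h) ^+ (k * k))).
  apply: ler_pM; rewrite ?exprn_ge0//; try lra.
    by apply: lerXn2r; rewrite ?nnegrE ?expR_ge0//; lra.
  by apply: lerXn2r; rewrite ?nnegrE ?expR_ge0//; lra.
rewrite -!expRM_natl -expRD ler_expR natrM.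
have n0 : 0 <= n%:R :> R by [].
have k2 : (delta * n%:R) ^+ 2 <= 4 * (k%:R * k%:R).
  have : 0 <= delta * n%:R by rewrite mulr_ge0// ltW.
  rewrite expr2; nra.
have h2 : 12 <= n%:R * h * delta ^+ 2 by move: nh; rewrite ler_pdivrMr// exprn_gt0.
have h3 : h * (delta * n%:R) ^+ 2 <= h * (4 * (k%:R * k%:R)).
  by apply: ler_wpM2l => //; case/andP: h01.
have h4 : 12 * n%:R <= n%:R * h * delta ^+ 2 * n%:R by apply: ler_wpM2r.
rewrite exprMn in h3.
have h5 : n%:R * h * delta ^+ 2 * n%:R = h * (delta ^+ 2 * n%:R ^+ 2) by rewrite expr2; lra.
lra.
Qed.

(** Both tail regimes are instances, with their own levels [b] and [c]. Divergence of [n g(c n)]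
    makes the pairs of sets without heavy edges unlikely, and [n^2 g(b n) -> 0] disposes of the
    union bound over edges. *)
Lemma last_passage_time_limit (R : realType)
  (d : nat -> measure_display) (T : forall n : nat, measurableType (d n))
  (P : forall n : nat, probability (T n) R)
  (X : forall n : nat, edge n -> {RV (P n) >-> R}) (H g : R -> R)
  (b c : nat -> R) (eps : R) :
  (forall (n : nat) (e : edge n), {ae P n, forall w, 0 < X n e w}) ->
  (forall n : nat, independent_RVs (X n)) ->
  (forall (n : nat) (e : edge n) (x : R),
      P n [set w | X n e w > x] = (H x)%:E) ->
  (forall x, 0 < x -> 0 < g x) -> asymptotically_equivalent H g ->
  c n @[n --> \oo] --> +oo -> b n @[n --> \oo] --> +oo ->
  n%:R * g (c n) @[n --> \oo] --> +oo ->
  n%:R ^+ 2 * g (b n) @[n --> \oo] --> 0 ->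
  0 < eps ->
  P n [set w | (1 - eps) * c n <= last_passage_time (fun e => X n e w) / n%:R <= b n]
    @[n --> \oo] --> 1%E.
Proof.
move=> X0 Xi Xh g0 Hg cy by_ gc gb eps0.
(* The first term comes from [power_decay]; the factor 2 in the second from [H <= 2 g]. *)
pose u n : R := expR (- n%:R) + 2 * (n%:R ^+ 2 * g (b n)).
have u0 : u n @[n --> \oo] --> 0.
  rewrite -[X in _ --> X](addr0 0); apply: cvgD; first exact: cvgn_expR.
  by rewrite -[X in _ --> X](mulr0 2); apply: cvgM => //; exact: cvg_cst.
apply: (@squeeze_cvge _ _ _ _ (fun n => (1 - u n)%:E) _ (fun=> 1%E)); last 2 first.
- apply: cvg_EFin; first exact: nearW.
  rewrite /comp /= -[X in _ --> X](subr0 1).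
  by apply: cvgB => //; exact: cvg_cst.
- exact: cvg_cst.
have tail := asymptotically_equivalent_bounds g0 Hg.
have Hc : \forall n \near \oo, g (c n) / 2 <= H (c n) <= 2 * g (c n) by exact: (cy _ tail).
have Hb : \forall n \near \oo, g (b n) / 2 <= H (b n) <= 2 * g (b n) by exact: (by_ _ tail).
pose delta := eps / 4.
have d0 : 0 < delta by rewrite divr_gt0.
near=> n.
have n1 : (1 < n)%N by near: n; exact: nbhs_infty_gt.
have n0 : 0 < n%:R :> R by rewrite ltr0n ltnW.
have c0 : 0 < c n by near: n; exact: (cvgryPgt c).1.
have b0 : 0 < b n by near: n; exact: (cvgryPgt b).1.
have Hcn : g (c n) / 2 <= H (c n) <= 2 * g (c n) by near: n.
have Hbn : g (b n) / 2 <= H (b n) <= 2 * g (b n) by near: n.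
(* The constant is twice the 12 of [power_decay], because only [H >= g / 2] is available. *)
have gcn : 24 / delta ^+ 2 <= n%:R * g (c n) by near: n; exact: (cvgryPge _).1.
have dn : 2 / delta <= n%:R by near: n; exact: nbhs_infty_ger.
rewrite ler_pdivrMr// mulrC in dn.
(* Once [delta n >= 2], rounding down still leaves [2k >= delta n], while [2 + 2k <= 3 delta n] is
   below [eps n = 4 delta n]. *)
pose k := Num.truncn (delta * n%:R).
have dn0 : 0 <= delta * n%:R by rewrite mulr_ge0// ltW.
have /andP[k1 k2] := truncn_itv dn0.
rewrite -/k -natr1 in k1 k2.
apply/andP; split; last first.
  by apply: probability_le1; apply: measurable_last_passage_event => // e.
have e : edge n.
  case: (n) n1 => [|[|m]] //= _.
  by exists (ord0, ord_max).
have H01 : 0 <= H (c n) <= 1.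
  have mS : measurable [set w | X n e w > c n].
    by rewrite -preimage_itvoy; exact: measurable_funPTI.
  by rewrite -!lee_fin -(Xh n e) measure_ge0 probability_le1.
have ac : (1 - eps) * c n * n%:R <= (n%:R - 2 - (2 * k)%:R) * c n.
  rewrite mulrAC; apply: ler_wpM2r; [exact: ltW|rewrite natrM].
  have -> : eps = 4 * delta by rewrite /delta; lra.
  lra.
apply: le_trans (last_passage_time_probability n1 (ltW b0) (ltW c0) ac
  (X0 n) (Xi n) (Xh n)).
rewrite lee_fin lerD2l lerN2 /u lerD//.
  apply: (@power_decay _ _ _ delta) => //; first by lra.
  rewrite ler_pdivrMr ?exprn_gt0//.
  move: gcn; rewrite ler_pdivrMr ?exprn_gt0// => gcn.
  have : n%:R * delta ^+ 2 * (g (c n) / 2) <= n%:R * delta ^+ 2 * H (c n).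
    apply: ler_wpM2l; first by rewrite mulr_ge0 ?exprn_ge0// ltW.
    by case/andP: Hcn.
  lra.
rewrite mulrCA ler_wpM2l ?exprn_ge0//.
by case/andP: Hbn.
Unshelve. all: by end_near. Qed.

(** * Growth of logarithms and powers *)

Lemma cvgr_ln (R : realType) : ln x @[x --> +oo%R] --> (+oo%R : set_system R).
Proof.
apply/cvgryPge => A; near=> x.
have Ax : expR A <= x by near: x; exact: nbhs_pinfty_ge.
by rewrite -[A]expRK ler_ln ?posrE ?expR_gt0// (lt_le_trans (expR_gt0 A)).
Unshelve. all: by end_near. Qed.

Lemma cvgr_powR (R : realType) (p : R) : 0 < p ->
  x `^ p @[x --> +oo%R] --> (+oo%R : set_system R).
Proof.
move=> p0; apply/cvgryPge => A; near=> x.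
have x0 : 0 < x by near: x; exact: nbhs_pinfty_gt.
have Ax : A / p <= ln x by near: x; exact: (cvgryPge _).1 (@cvgr_ln R) _.
rewrite /powR gt_eqF//; apply: le_trans (expR_ge1Dx _).
by move: Ax; rewrite ler_pdivrMr// mulrC; lra.
Unshelve. all: by end_near. Qed.

(** The quadratic term of the exponential gives [x >= (ln x)^2 / 2], so the quotient is at least
    [ln x / 2]. *)
Lemma cvgr_div_ln (R : realType) :
  x / ln x @[x --> +oo%R] --> (+oo%R : set_system R).
Proof.
apply/cvgryPge => A; near=> x.
have x0 : 0 < x by near: x; exact: nbhs_pinfty_gt.
have lx : 0 < ln x by near: x; exact: (cvgryPgt _).1 (@cvgr_ln R) _.
have Ax : 2 * A <= ln x by near: x; exact: (cvgryPge _).1 (@cvgr_ln R) _.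
rewrite ler_pdivlMr//.
have := expR_ge1Dxn 1 (ltW lx); rewrite lnK ?posrE// expr2.
have -> : (2%N)`!%:R = 2 :> R by [].
nra.
Unshelve. all: by end_near. Qed.

(** * The exponential and the polynomial tail *)

Unset Implicit Arguments.
Set Strict Implicit.

Theorem corollary1p3 (R : realType)
  (d : nat -> measure_display) (T : forall n : nat, measurableType (d n))
  (P : forall n : nat, probability (T n) R)
  (X : forall n : nat, edge n -> {RV (P n) >-> R})
  (law : probability (measurableTypeR R) R) (H : R -> R)
  (X_gt0 : forall (n : nat) (e : edge n), {ae P n, forall w, 0 < X n e w})
  (X_indep : forall n : nat, independent_RVs (X n))
  (X_law : forall (n : nat) (e : edge n) (B : set R),
      measurable B -> distribution (P n) (X n e) B = law B)
  (H_tail : forall (n : nat) (e : edge n) (x : R),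
      P n [set w | X n e w > x] = (H x)%:E) :
  let W (n : nat) (w : T n) : R := last_passage_time (fun e => X n e w) in
  (forall lambda : R, 0 < lambda ->
     asymptotically_equivalent H (fun x => expR (- lambda * x)) ->
     forall eps : R, 0 < eps ->
       P n [set w |
         (1 - eps) * ((ln n%:R - ln (ln n%:R)) / lambda) <= W n w / n%:R
           <= (2 * ln n%:R + ln (ln n%:R)) / lambda]
       @[n --> \oo] --> 1%E)
  /\
  (forall alpha : R, 0 < alpha ->
     asymptotically_equivalent H (fun x => x `^ (- alpha)) ->
     forall eps : R, 0 < eps ->
       P n [set w |
         (1 - eps) * n%:R `^ (1 / alpha) * ln n%:R `^ (- (1 / alpha))
           <= W n w / n%:R
           <= n%:R `^ (2 / alpha) * ln (ln n%:R) `^ (1 / alpha)]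
       @[n --> \oo] --> 1%E).
Proof.
move=> W.
have lnn : ln n%:R @[n --> \oo] --> (+oo : set_system R).
  exact: cvg_comp _ _ cvgr_idn (@cvgr_ln R).
have lnlnn : ln (ln n%:R) @[n --> \oo] --> (+oo : set_system R).
  exact: cvg_comp _ _ lnn (@cvgr_ln R).
have nlnn : n%:R / ln n%:R @[n --> \oo] --> (+oo : set_system R).
  exact: cvg_comp _ _ cvgr_idn (@cvgr_div_ln R).
pose pos n := [/\ 0 < n%:R :> R, 0 < ln n%:R :> R & 0 < ln (ln n%:R) :> R].
have near_pos : \forall n \near \oo, pos n.
  near=> n; split; near: n.
  - exact: (cvgryPgt _).1 cvgr_idn _.
  - exact: (cvgryPgt _).1 lnn _.
  - exact: (cvgryPgt _).1 lnlnn _.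
split.
  move=> lambda l0 Heq eps eps0.
  (* For [g x = e^(-lambda x)] the levels give [n g(c n) = ln n] and [n^2 g(b n) = 1 / ln n] for
     large [n]. *)
  apply: (last_passage_time_limit X_gt0 X_indep H_tail _ Heq) => //.
  - by move=> x _; exact: expR_gt0.
  (* The lower level is [ln (n / ln n) / lambda]. *)
  - apply/cvgryPge => A; near=> n.
    have [n0 ln0 _] : pos n by near: n.
    rewrite ler_pdivlMr// -ln_div ?posrE//; near: n.
    exact: (cvgryPge _).1 (cvg_comp _ _ nlnn (@cvgr_ln R)) _.
  - apply/cvgryPge => A; near=> n.
    have [n0 ln0 ll0] : pos n by near: n.
    have : A * lambda <= ln n%:R by near: n; exact: (cvgryPge _).1 lnn _.
    by rewrite ler_pdivlMr//; lra.
  - apply: cvg_trans lnn; apply: near_eq_cvg; near=> n.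
    have [n0 ln0 _] : pos n by near: n.
    rewrite mulNr mulrCA divff ?gt_eqF// mulr1 opprB expRB !lnK ?posrE//.
    by rewrite mulrCA divff ?gt_eqF// mulr1.
  - have : (ln n%:R)^-1 @[n --> \oo] --> (0 : R).
      by apply/gtr0_cvgV0 => //; near=> n; near: n; exact: (cvgryPgt _).1 lnn _.
    apply: cvg_trans; apply: near_eq_cvg; near=> n.
    have [n0 ln0 _] : pos n by near: n.
    rewrite mulNr mulrCA divff ?gt_eqF// mulr1 opprD expRD !expRN.
    rewrite expRM_natl !lnK ?posrE//.
    by rewrite mulrA divff ?mul1r// expf_neq0// gt_eqF.
move=> alpha a0 Heq eps eps0.
have ia0 : 0 < 1 / alpha by rewrite divr_gt0.
have powK (x : R) : 0 < x -> (x `^ (1 / alpha)) `^ (- alpha) = x^-1.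
  move=> x0; rewrite -powRrM mulrN divfK ?gt_eqF// powR_inv1 ?ltW//.
(* Reassociating isolates the level [c n] as a single factor of [1 - eps]. *)
under eq_cvg do under eq_set do rewrite -mulrA.
(* For [g x = x^(-alpha)] the levels give [n g(c n) = ln n] and [n^2 g(b n) = 1 / ln (ln n)] for
   large [n]. *)
apply: (last_passage_time_limit X_gt0 X_indep H_tail _ Heq) => //.
- by move=> x x0; exact: powR_gt0.
(* The lower level is eventually [(n / ln n)^(1 / alpha)]. *)
- apply: cvg_trans (cvg_comp _ _ nlnn (cvgr_powR ia0)).
  apply: near_eq_cvg; near=> n => /=.
  have [n0 ln0 _] : pos n by near: n.
  by rewrite powRM ?invr_ge0 ?ltW// -[(ln _)^-1]powR_inv1 ?ltW// -powRrM mulN1r.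
- apply/cvgryPge => A; near=> n.
  have n1 : 1 <= n%:R :> R by near: n; exact: nbhs_infty_ger.
  have [n0 ln0 ll0] : pos n by near: n.
  have h : A <= ln (ln n%:R) `^ (1 / alpha).
    by near: n; exact: (cvgryPge _).1 (cvg_comp _ _ lnlnn (cvgr_powR ia0)) _.
  apply: (le_trans h); rewrite ler_peMl ?powR_ge0//.
  have : 1 `^ (2 / alpha) <= n%:R `^ (2 / alpha).
    by rewrite ge0_ler_powR ?nnegrE// divr_ge0// ltW.
  by rewrite powR1.
- apply: cvg_trans lnn; apply: near_eq_cvg; near=> n.
  have [n0 ln0 _] : pos n by near: n.
  rewrite powRM ?powR_ge0// powK// -powRrM mulrNN divfK ?gt_eqF// powRr1 ?(ltW ln0)//.
  by rewrite mulrA divff ?mul1r// gt_eqF.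
- have : (ln (ln n%:R))^-1 @[n --> \oo] --> (0 : R).
    by apply/gtr0_cvgV0 => //; near=> n; near: n; exact: (cvgryPgt _).1 lnlnn _.
  apply: cvg_trans; apply: near_eq_cvg; near=> n.
  have [n0 ln0 ll0] : pos n by near: n.
  rewrite powRM ?powR_ge0// powK// -powRrM mulrN divfK ?gt_eqF// powRN powR_mulrn ?ltW//.
  by rewrite mulrA divff ?mul1r// expf_neq0// gt_eqF.
Unshelve. all: by end_near. Qed.
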